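(* Let $\Sigma\subset N$ be a nonempty fan. The irrational toric variety $Y_\Sigma$ is a compact topological space if and only if the fan $\Sigma$ is complete.
   Context: $M$ and $N$ are dual finite-dimensional real vector spaces with pairing $u\cdot v$; $\mathbb{R}_>$, $\mathbb{R}_\geq$ are the positive and nonnegative reals. A polyhedral cone is a set $\mathbb{R}_\geq v_1+\dots+\mathbb{R}_\geq v_k$; the dual of a cone $\sigma\subset N$ is $\sigma^\vee=\{u\in M\mid u\cdot v\geq0\ \forall v\in\sigma\}$. A face of $\sigma$ is a set $\{v\in\sigma\mid u\cdot v=0\}$ with $u\in\sigma^\vee$, and similarly for cones in $M$. A fan $\Sigma\subset N$ is a finite collection of polyhedral cones in $N$ closed under taking faces such that any two of its cones meet in a common face. $\Sigma$ is complete if every point of $N$ lies in some cone of $\Sigma$. For a polyhedral cone $C\subset M$, $\mathrm{Hom}_c(C,\mathbb{R}_\geq)$ is the set of monoid homomorphisms $\varphi\colon(C,+)\to(\mathbb{R}_\geq,\times)$ (so $\varphi(0)=1$) that are continuous on the relative interior of each face of $C$, with the weakest topology making all evaluations at points of $C$ continuous. For $\sigma\in\Sigma$ put $V_\sigma=\mathrm{Hom}_c(\sigma^\vee,\mathbb{R}_\geq)$. For $\tau$ a face of $\sigma$, restriction from $\tau^\vee$ to $\sigma^\vee$ gives an inclusion $V_\tau\hookrightarrow V_\sigma$. The irrational toric variety $Y_\Sigma=\bigcup_{\sigma\in\Sigma}V_\sigma$ is obtained by gluing the $V_\sigma$ along these inclusions. *)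

(* Defs.v *)
From HB Require Import structures.
From Stdlib Require Import Relation_Operators.
From mathcomp Require Import all_boot all_order all_algebra sesquilinear.
From mathcomp Require Import generic_quotient.
From mathcomp Require Import all_classical all_reals topology normedtype.

Set Implicit Arguments.
Unset Strict Implicit.
Unset Printing Implicit Defensive.

Import Order.TTheory GRing.Theory Num.Theory.
Import numFieldNormedType.Exports.

Local Open Scope classical_set_scope.
Local Open Scope ring_scope.
Local Open Scope quotient_scope.

Section Cones.
Context {R : realType}.

Definition polyhedral_cone (V : vectType R) (C : set V) : Prop :=
  exists (k : nat) (w : 'I_k -> V),
    C = [set x | exists2 a : 'I_k -> R,
                   forall i, 0 <= a i & x = \sum_(i < k) a i *: w i].

Definition nondegenerate_pairing (M N : vectType R) (p : M -> N -> R) : Prop :=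
  (forall u, (forall v, p u v = 0) -> u = 0) /\
  (forall v, (forall u, p u v = 0) -> v = 0).

Definition dual_cone (M N : vectType R) (p : M -> N -> R) (S : set N) : set M :=
  [set u | forall v, S v -> 0 <= p u v].

(* Faces of a cone in M are obtained by passing the transposed pairing
   [fun v u => p u v]. *)
Definition face_of (M N : vectType R) (p : M -> N -> R) (F S : set N) : Prop :=
  exists2 u, dual_cone p S u & F = S `&` [set v | p u v = 0].

Definition fan (M N : vectType R) (p : M -> N -> R)
    (Sigma : set (set N)) : Prop :=
  [/\ finite_set Sigma,
      forall s, Sigma s -> polyhedral_cone s,
      forall s t, Sigma s -> face_of p t s -> Sigma t &
      forall s t, Sigma s -> Sigma t ->
        face_of p (s `&` t) s /\ face_of p (s `&` t) t].

Definition complete_fan (N : vectType R) (Sigma : set (set N)) : Prop :=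
  forall v, exists2 s, Sigma s & s v.

(* The usual topology of a finite-dimensional real vector space, transported
   from 'rV[R]_n along coordinates; it does not depend on the basis. *)
Definition vect_top (V : vectType R) : topologicalType :=
  initial_topology
    (fun v : V => \row_(i < \dim {:V}) coord (vbasis {:V}) i v).

Definition affine_hull (V : vectType R) (C : set V) : set V :=
  [set x | exists (k : nat) (w : 'I_k -> V) (a : 'I_k -> R),
     [/\ forall i, C (w i), \sum_(i < k) a i = 1
       & x = \sum_(i < k) a i *: w i]].

Definition relint (V : vectType R) (C : set V) : set V :=
  [set x | C x /\ within (affine_hull C) (nbhs (x : vect_top V)) C].

(* Hom_c(C, R_>=) as a set of functions on the subtype of C; as a subspace of
   {ptws C -> R} it carries the weakest topology making all evaluations
   continuous. The sum in C is expressed through the inclusion of C in M. *)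
Definition homc (M N : vectType R) (p : M -> N -> R) (C : set M) :
    set {ptws C -> R} :=
  [set f | [/\ forall x, 0 <= f x,
               forall z : C, \val z = 0 -> f z = 1,
               forall x y z : C, \val z = \val x + \val y -> f z = f x * f y &
               forall F, face_of (fun v u => p u v) F C ->
                 {within [set x : (C : set (vect_top M)) | relint F (\val x)],
                   continuous (f : (C : set (vect_top M)) -> R)}]].

End Cones.

Arguments homc {R M N} p C _.

Section ToricVariety.
Context {R : realType} {M N : vectType R}.
Variables (p : M -> N -> R) (Sigma : set (set N)).

Definition chart (s : set N) : topologicalType := homc p (dual_cone p s).

Definition charts : topologicalType := {s : Sigma & chart (\val s)}.

(* For t a face of s, (t, f) is glued to (s, g) when g is the restriction of f
   from the dual of t to the (smaller) dual of s. *)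
Definition glue (a b : charts) : Prop :=
  face_of p (\val (projT1 a)) (\val (projT1 b)) /\
  forall (x : dual_cone p (\val (projT1 b)))
         (y : dual_cone p (\val (projT1 a))),
    \val x = \val y -> \val (projT2 b) x = \val (projT2 a) y.

Definition glue_rel : rel charts :=
  fun a b => `[< clos_refl_sym_trans charts glue a b >].

Lemma glue_rel_refl : reflexive glue_rel.
Proof. by move=> a; apply/asboolP; exact: rst_refl. Qed.

Lemma glue_rel_sym : symmetric glue_rel.
Proof.
by move=> a b; apply/asboolP/asboolP => ab; exact: rst_sym.
Qed.

Lemma glue_rel_trans : transitive glue_rel.
Proof.
by move=> b a c /asboolP ab /asboolP bc; apply/asboolP; exact: rst_trans bc.
Qed.

Canonical glue_equiv : equiv_rel charts :=
  EquivRel glue_rel glue_rel_refl glue_rel_sym glue_rel_trans.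

Definition irrational_toric_variety : topologicalType :=
  quotient_topology {eq_quot glue_equiv}.

End ToricVariety.

(* Main.v *)
Require Import Defs.
From mathcomp Require Import all_boot all_order all_algebra sesquilinear.
From mathcomp Require Import generic_quotient finmap.
From mathcomp Require Import all_classical all_reals topology normedtype.
From mathcomp Require Import sequences exp derive.
From mathcomp Require Import ring lra zify.

(** A point of the variety is given, in the chart of a cone [s], by a
    function on the dual cone of [s] that is an exponential
    [x |-> expR (- p x v)] on some face and zero elsewhere. The face is the
    part of the dual cone orthogonal to a face [T] of [s], and the logarithm
    is linear there because it is additive and continuous on the relative
    interior ([homc_orbit_point]).

    If the fan is complete, then [v] can be moved by a vector of [T], which
    does not change the point, until it lies in a cone [t] of the fan that
    has [T] as a face. In the chart of [t] the point then takes values at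
    most one ([complete_bounded_representative]). Hence the variety is the
    union of the finitely many images of the sets of homomorphisms into
    [0, 1]. Such a set is compact by Tychonoff's theorem, because a bounded
    homomorphism on a cone is automatically continuous on the relative
    interior of each face ([monoid_hom_homc], [bounded_chart_compact]).

    If [v] lies in no cone of the fan, then the points
    [x |-> expR (- r * p x v)] of the dense torus have no cluster point as
    [r] tends to infinity. Indeed, by Farkas' lemma each chart has a
    functional [u] with [p u v < 0], so the values at [u] tend to infinity
    and the tails of this curve are closed in the chart ([closed_ray_tail]).
    A tail is also a union of gluing classes ([glue_invariant_ray_tail]), so
    it is closed in the variety, and the tails have empty intersection
    ([compact_complete]). *)

Set Implicit Arguments.
Unset Strict Implicit.
Unset Printing Implicit Defensive.

Import Order.TTheory GRing.Theory Num.Theory.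
Import numFieldNormedType.Exports.

Local Open Scope classical_set_scope.
Local Open Scope ring_scope.
Local Open Scope quotient_scope.

(** * Generalities *)

Lemma exists_set_val (T : Type) (A : set T) x : A x -> exists y : A, \val y = x.
Proof. by move=> /mem_set Ax; exists (exist _ x Ax). Qed.

Lemma face_of_subset (R : realType) (M N : vectType R) (q : M -> N -> R)
  (F S : set N) : face_of q F S -> F `<=` S.
Proof. by move=> [u _ ->] x []. Qed.

Lemma closed_equalizer (R : realType) (T : topologicalType) (h k : T -> R) :
  continuous h -> continuous k -> closed [set x | h x = k x].
Proof.
move=> hc kc; rewrite (_ : mkset _ = (h \- k) @^-1` [set 0]); last first.
  apply/seteqP; split=> x /=; first by move=> ->; exact: subrr.
  exact: subr0_eq.
apply: preimage_closed; last exact: closed_eq.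
by move=> x _; apply: cvgB; [exact: hc|exact: kc].
Qed.

(** * Linear forms and the pairing *)

(** A free family of maximal length among those drawn from [F] spans [F]. *)
Lemma exists_free_spanning (K : fieldType) (V : vectType K) (F : set V) :
  exists b : seq V, [/\ free b, forall x, x \in b -> F x &
    forall x, F x -> x \in <<b>>%VS].
Proof.
suff H n : forall b : seq V, free b -> (forall x, x \in b -> F x) ->
    (\dim {:V} - size b <= n)%N ->
    exists b : seq V, [/\ free b, forall x, x \in b -> F x &
      forall x, F x -> x \in <<b>>%VS].
  by apply: (H _ [::] _ _ (leqnn _)); [exact: nil_free|].
elim: n => [|n IH] b bfree bF sb.
  exists b; split=> // x Fx; apply: contraT => xb.
  have := dimvS (subvf <<x :: b>>%VS).
  have /eqP -> : free (x :: b) by rewrite free_cons xb.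
  by rewrite /=; lia.
have [spanb|] := pselect (forall x, F x -> x \in <<b>>%VS); first by exists b.
move=> /existsNP[x /not_implyP[Fx /negP xb]].
apply: (IH (x :: b)); [by rewrite free_cons xb| |by rewrite /=; lia].
by move=> y; rewrite inE => /predU1P[->|/bF].
Qed.

Section Pairing.
Context {R : realType} {M N : vectType R}.
Variable p : {bilinear M -> N -> R | *%R & *%R}.

Lemma pairingZl a u v : p (a *: u) v = a * p u v.
Proof. exact: linearZl_LR. Qed.

Lemma pairingZr a u v : p u (a *: v) = a * p u v.
Proof. exact: linearZr_LR. Qed.

(** Bartl's induction on the number of generators. If the first generator
    cannot be dropped, there is a functional [x0] that is nonnegative on the
    others and negative on [v], hence negative on [w ord0]. The shear [sh],
    which translates along [w ord0] so that every image pairs to zero with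
    [x0], reduces the claim to the remaining generators. *)
Lemma farkas k (w : 'I_k -> N) (v : N) :
  (forall v, (forall u, p u v = 0) -> v = 0) ->
  (forall u, (forall i, 0 <= p u (w i)) -> 0 <= p u v) ->
  exists2 a : 'I_k -> R, forall i, 0 <= a i & v = \sum_(i < k) a i *: w i.
Proof.
move=> ndeg; elim: k w v => [|k IH] w v wv.
  exists (fun=> 0) => //; rewrite big_ord0; apply: ndeg => u.
  have pv_ge0 u' : 0 <= p u' v by apply: wv => -[].
  by apply/eqP; rewrite eq_le pv_ge0 -oppr_ge0 -linearNl pv_ge0.
have [wv'|] := pselect (forall u,
    (forall i : 'I_k, 0 <= p u (w (lift ord0 i))) -> 0 <= p u v).
  have [a a0 ->] := IH _ _ wv'.
  exists (fun i => if unlift ord0 i is Some j then a j else 0).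
    by move=> i; case: unliftP.
  rewrite big_ord_recl unlift_none scale0r add0r.
  by apply: eq_bigr => i _; rewrite liftK.
move=> /existsNP[x0 /not_implyP[x0w /negP]]; rewrite -ltNge => x0v.
have x0w0 : p x0 (w ord0) < 0.
  rewrite ltNge; apply/negP => w0; suff : 0 <= p x0 v by rewrite leNgt x0v.
  by apply: wv => i; case: (unliftP ord0 i) => [j ->|->].
pose c := - (p x0 (w ord0))^-1.
have c0 : 0 < c by rewrite oppr_gt0 invr_lt0.
have cE : c * p x0 (w ord0) = -1.
  by rewrite mulNr mulVf// lt_eqF.
pose sh y := y + (c * p x0 y) *: w ord0.
have shE u y : p u (sh y) = p (u + (c * p u (w ord0)) *: x0) y.
  by rewrite linearDr linearDl pairingZr pairingZl /=; ring.
have [|a a0 shv] := IH (fun i => sh (w (lift ord0 i))) (sh v).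
  move=> u uw; rewrite shE; apply: wv => i.
  case: (unliftP ord0 i) => [j ->|->]; first by rewrite -shE.
  rewrite linearDl pairingZl /= [c * _]mulrC -mulrA cE; lra.
exists (fun i => if unlift ord0 i is Some j then a j else
   \sum_j a j * (c * p x0 (w (lift ord0 j))) - c * p x0 v).
  move=> i; case: unliftP => // _.
  rewrite subr_ge0 (@le_trans _ _ 0)//.
    by rewrite pmulr_rle0// ltW.
  by apply: sumr_ge0 => j _; rewrite mulr_ge0// mulr_ge0// ltW.
rewrite big_ord_recl unlift_none scalerBl scaler_suml.
under [X in _ = _ + X]eq_bigr do rewrite liftK.
apply: (etrans (canRL (addrK _) shv)).
rewrite addrAC -big_split/=; congr (_ - _); apply: eq_bigr => j _.
by rewrite /sh scalerDr scalerA addrC.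
Qed.

(** The Gram matrix of the [b`_i] against a basis of [N] has independent rows,
    because a linear relation between its rows would be a combination of the
    [b`_i] that pairs to zero with all of [N]; so it has a right inverse. *)
Lemma pairing_interpolation n (b : n.-tuple M) (c : 'I_n -> R) :
  (forall u, (forall v, p u v = 0) -> u = 0) ->
  free b -> exists v, forall i : 'I_n, p b`_i v = c i.
Proof.
move=> ndeg /freeP bfree; pose e := vbasis {:N}.
pose B := \matrix_(i < n, j < \dim {:N}) p b`_i e`_j.
have /row_freeP[B' BB'] : row_free B.
  apply: inj_row_free => k kB; apply/rowP => i; rewrite mxE.
  apply: (bfree (fun i => k 0 i)); apply: ndeg => v.
  rewrite (coord_vbasis (memvf v)) linear_sumr big1// => j _.
  rewrite pairingZr linear_sumlz.
  have /rowP/(_ j) := kB; rewrite !mxE => kB0.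
  apply/eqP; rewrite mulf_eq0; apply/orP; right; rewrite -[X in _ == X]kB0.
  by apply/eqP; apply: eq_bigr => l _; rewrite pairingZl mxE.
exists (\sum_j (B' *m \col_i c i) j 0 *: e`_j) => i.
transitivity ((B *m (B' *m \col_i c i)) i 0).
  rewrite linear_sumr [RHS]mxE; apply: eq_bigr => j _.
  by rewrite pairingZr [B i j]mxE mulrC.
by rewrite mulmxA BB' mul1mx mxE.
Qed.

Definition convex_cone (C : set M) :=
  [/\ C 0, forall x y, C x -> C y -> C (x + y) &
    forall t x, 0 <= t -> C x -> C (t *: x)].

Lemma convex_cone_sum C : convex_cone C -> forall n (a : 'I_n -> R)
  (w : 'I_n -> M), (forall i, 0 <= a i) -> (forall i, C (w i)) ->
  C (\sum_i a i *: w i).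
Proof.
move=> [C0 CD CZ] n a w a0 Cw.
by apply: (big_ind C) => // i _; exact: CZ.
Qed.

(** Interpolate [g] on a basis of the span that consists of points of the
    cone. The difference [h] with the interpolating form vanishes on all
    nonnegative combinations of that basis. *)
Lemma additive_on_cone_eq_pairing C (g : M -> R) :
  (forall u, (forall v, p u v = 0) -> u = 0) ->
  convex_cone C -> (forall x y, C x -> C y -> g (x + y) = g x + g y) ->
  (forall t x, 0 < t -> C x -> g (t *: x) = t * g x) ->
  exists v, forall x, C x -> g x = p x v.
Proof.
move=> ndeg CC gD gZ; have [C0 CD CZ] := CC.
have [b [bfree bC Cb]] := exists_free_spanning C.
have [v vE] :=
  @pairing_interpolation _ (in_tuple b) (fun i => g b`_i) ndeg bfree.
exists v => x Cx; pose h y := g y - p y v.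
have hD y z : C y -> C z -> h (y + z) = h y + h z.
  by move=> Cy Cz; rewrite /h gD// linearDl/=; ring.
have h0 : h 0 = 0 by have := hD _ _ C0 C0; rewrite addr0; lra.
have hZ t y : 0 <= t -> C y -> h (t *: y) = t * h y.
  move=> + Cy; rewrite le_eqVlt => /predU1P[<-|t0].
    by rewrite scale0r mul0r h0.
  by rewrite /h gZ// pairingZl; ring.
have bi (i : 'I_(size b)) : C b`_i by apply: bC; exact: mem_nth.
have hsum (a : 'I_(size b) -> R) : (forall i, 0 <= a i) ->
    C (\sum_i a i *: b`_i) /\ h (\sum_i a i *: b`_i) = 0.
  move=> a0.
  apply: (big_ind (fun y => C y /\ h y = 0)) => //.
    move=> y z [Cy hy] [Cz hz]; split; first exact: CD.
    by rewrite hD// hy hz addr0.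
  move=> i _; split; first exact: CZ.
  by rewrite hZ// /h -vE/= subrr mulr0.
apply/eqP; rewrite -subr_eq0; apply/eqP; rewrite -/(h x).
pose a i := coord (in_tuple b) i x.
have xE : x = \sum_i a i *: b`_i by apply: coord_span; exact: Cb.
(* x + sum |a_i| b_i = sum (|a_i| + a_i) b_i writes x as a difference of two
   nonnegative combinations *)
have [] := hsum (fun i => `|a i| + a i).
  by move=> i; have := ler_norm (- a i); rewrite normrN; lra.
have [|CP hP] := hsum (fun i => `|a i|); first by move=> i; exact: normr_ge0.
under eq_bigr do rewrite scalerDl.
by rewrite big_split/= -xE hD// hP add0r.
Qed.

End Pairing.

(** * Cauchy's functional equation on the half-line *)

(** The additive function [k t = h t - t * h 1] vanishes at 1, hence
    is invariant under translation by integers, hence bounded on the half-line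
    beyond 1. As [k (n * t) = n * k t], boundedness forces [k] to
    vanish.

    Boundedness on [1, 2] is what two different situations have in common:
    continuity along a ray and monotonicity. *)
Lemma bounded_additive_linear (R : realType) (h : R -> R) (B : R) :
  (forall s t, 0 < s -> 0 < t -> h (s + t) = h s + h t) ->
  (forall t, 1 <= t <= 2 -> `|h t| <= B) ->
  forall t, 0 < t -> h t = t * h 1.
Proof.
move=> hD hB; pose k t := h t - t * h 1.
have kD s t : 0 < s -> 0 < t -> k (s + t) = k s + k t.
  by move=> s0 t0; rewrite /k hD//; ring.
have k1 : k 1 = 0 by rewrite /k mul1r subrr.
have kDn t n : 0 < t -> k (t + n%:R) = k t.
  move=> t0; elim: n => [|n IH]; first by rewrite addr0.
  rewrite -natr1 addrA kD ?IH ?k1 ?addr0//.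
  by rewrite (lt_le_trans t0)// lerDl.
have kM t n : 0 < t -> k (n.+1%:R * t) = n.+1%:R * k t.
  move=> t0; elim: n => [|n IH]; first by rewrite !mul1r.
  by rewrite -natr1 mulrDl mul1r kD ?mulr_gt0// IH; ring.
have kB t : 1 <= t -> `|k t| <= B + 2 * `|h 1|.
  move=> t1; have t0 : 0 <= t - 1 by lra.
  have /andP[le_t lt_t] := Num.Theory.truncn_itv t0.
  set n := Num.truncn _ in le_t lt_t; rewrite -natr1 in lt_t.
  rewrite -(subrK n%:R t) kDn; last by lra.
  rewrite /k (le_trans (ler_normB _ _))// lerD//; first by apply: hB; lra.
  by rewrite normrM ler_wpM2r// ger0_norm; lra.
move=> t t0; apply/eqP; rewrite -subr_eq0 -/(k t); apply/contraT => kt0.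
have kt : 0 < `|k t| by rewrite normr_gt0.
have B0 : 0 <= B + 2 * `|h 1|.
  by apply: le_trans (kB 1 (lexx _)).
have /archi_boundP : 0 <= t^-1 + (B + 2 * `|h 1|) / `|k t|.
  by rewrite addr_ge0// ?divr_ge0// ?invr_ge0// ltW.
set n := Num.bound _ => ltn; have := kM t n t0.
have ltn1 : t^-1 + (B + 2 * `|h 1|) / `|k t| < n.+1%:R.
  by rewrite (lt_trans ltn)// ltr_nat.
have : 1 <= n.+1%:R * t.
  rewrite -ler_pdivrMr// div1r; apply: le_trans (ltW ltn1).
  by rewrite lerDl divr_ge0// ltW.
move=> /kB /[swap] ->; rewrite normrM ger0_norm// -ler_pdivlMr//.
rewrite leNgt => /negP; elim; apply: le_lt_trans ltn1.
by rewrite lerDr invr_ge0 ltW.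
Qed.

(** * Topology of a finite-dimensional space and relative interiors *)

Section VectorTopology.
Context {R : realType} {V : vectType R}.

Lemma affine_curve_continuous (x y : V) :
  continuous (fun t : R => (x + t *: y) : vect_top V).
Proof.
apply: continuous_comp_initial => t.
pose r (z : V) : 'rV[R]_(\dim {:V}) := \row_i coord (vbasis {:V}) i z.
rewrite (_ : _ \o _ = fun t => r x + t *: r y); last first.
  by apply/funext => s; apply/rowP => i; rewrite !mxE linearD linearZ.
by apply: cvgD; [exact: cvg_cst|apply: cvgZr_tmp; exact: cvg_id].
Qed.

Lemma linear_form_continuous (f : V -> R) :
  (forall x y, f (x + y) = f x + f y) -> (forall a x, f (a *: x) = a * f x) ->
  continuous (f : vect_top V -> R).
Proof.
move=> fD fZ.
have f0 : f 0 = 0 by rewrite -(scale0r 0) fZ mul0r.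
pose r (z : V) : 'rV[R]_(\dim {:V}) := \row_i coord (vbasis {:V}) i z.
rewrite (_ : f = (fun s : 'rV[R]_(\dim {:V}) =>
    \sum_i s 0 i * f (vbasis {:V})`_i) \o r); last first.
  apply/funext => z /=; rewrite {1}(coord_vbasis (memvf z)) (big_morph f fD f0).
  by apply: eq_bigr => i _; rewrite fZ mxE.
move=> z; apply: continuous_comp; first exact: initial_continuous.
apply: (continuous_big (op := +%R)) => [|i _]; first exact: add_continuous.
by move=> s; apply: (@cvgMr_tmp _ _ (nbhs s)); exact: coord_continuous.
Qed.

End VectorTopology.

Section RelativeInterior.
Context {R : realType} {V : vectType R}.
Implicit Types (C : set V) (x y z : V).

Lemma affine_hull_sub_span C (U : {vspace V}) :
  (forall x, C x -> x \in U) -> forall x, affine_hull C x -> x \in U.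
Proof.
move=> CU _ [k [w [a [Cw _ ->]]]].
by apply: memv_suml => i _; apply/memvZ/CU.
Qed.

(** Near the point, the coordinates of [z - x] stay positive, and inside the
    span of [b] this expresses [z] as a sum of elements of the cone. In
    particular a convex cone has relative interior points, and those found
    here remain so when a point of the cone is added. *)
Lemma relint_positive_combination C (b : seq V) (c : 'I_(size b) -> R) x :
  convex_cone C -> free b -> (forall y, y \in b -> C y) ->
  (forall y, C y -> y \in <<b>>%VS) -> (forall i, 0 < c i) -> C x ->
  relint C (\sum_i c i *: b`_i + x).
Proof.
move=> CC bfree bC Cb c0 Cx; have [_ CD _] := CC.
have bi (i : 'I_(size b)) : C b`_i by apply: bC; exact: mem_nth.
pose X : (size b).-tuple V := in_tuple b.
split; first by apply: CD => //; apply: convex_cone_sum => // i; exact: ltW.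
set z0 := _ + x.
have coordz0 i : coord X i x < coord X i z0.
  by rewrite /z0 linearD/= coord_sum_free// ltrDr.
have : \forall z \near (z0 : vect_top V), forall i, coord X i x < coord X i z.
  apply: (@filter_forall _ _ _ (nbhs (z0 : vect_top V)) _) => i.
  have coord_cont : continuous (coord X i : vect_top V -> R).
    by apply: linear_form_continuous => *; rewrite ?linearD ?linearZ.
  apply: (coord_cont z0 [set r | coord X i x < r]).
  by apply: open_nbhs_nbhs; split; [exact: open_gt|exact: coordz0].
rewrite /within; apply: filterS => z xz /(affine_hull_sub_span Cb) zb.
rewrite -(subrK x z); apply: CD => //.
rewrite (@coord_span _ _ _ X (z - x)); last by rewrite memvB// Cb.
by apply: convex_cone_sum => // i; rewrite linearB/= subr_ge0 ltW.
Qed.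

(** A segment that ends at a relative interior point can be prolonged a little
    beyond it inside the set. *)
Lemma relint_extend C x y : relint C y -> C x ->
  exists2 e, 0 < e & C (y + e *: (y - x)).
Proof.
move=> [Cy yC] Cx.
have : \forall t \near (0 : R), C (y + t *: (y - x)).
  have : \forall t \near (0 : R), affine_hull C (y + t *: (y - x)) ->
      C (y + t *: (y - x)).
    apply: (@affine_curve_continuous _ _ y (y - x) 0
      [set z | affine_hull C z -> C z]).
    by rewrite /= scale0r addr0.
  apply: filterS => t; apply.
  exists 2%N, (fun i => if i == ord0 then y else x).
  exists (fun i => if i == ord0 then 1 + t else - t); split.
  - by move=> i; case: ifP.
  - by rewrite !big_ord_recl big_ord0 /=; ring.
  - by rewrite !big_ord_recl big_ord0 /= addr0 scalerDl scale1r scalerBr scaleNr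
      addrA.
move=> /nbhs_ballP[e /= e0 eC]; exists (e / 2); first by rewrite divr_gt0.
by apply: eC; rewrite /ball/= sub0r normrN gtr0_norm ?divr_gt0//; lra.
Qed.

End RelativeInterior.

(** * Monoid homomorphisms on a convex cone *)

Section MonoidHomomorphisms.
Context {R : realType} {M N : vectType R}.
Variable p : {bilinear M -> N -> R | *%R & *%R}.
Hypothesis p_nondegenerate : nondegenerate_pairing p.
Implicit Types (C F : set M) (g : M -> R).

(** The homomorphism on a cone [C] is carried by a function on the whole
    space; this avoids working with points of a subtype. *)
Definition monoid_hom_on C g :=
  [/\ forall x, C x -> 0 <= g x, g 0 = 1 &
    forall x y, C x -> C y -> g (x + y) = g x * g y].

Lemma monoid_hom_natmul C g x n : convex_cone C -> monoid_hom_on C g -> C x ->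
  g (x *+ n) = g x ^+ n.
Proof.
move=> [C0 CD CZ] [g0 g1 gD] Cx; elim: n => [|n IH]; first by rewrite mulr0n g1.
have Cn : C (x *+ n) by rewrite -scaler_nat; apply: CZ.
by rewrite mulrS gD// IH exprS.
Qed.

(** On a ray, [ln g] is additive and nonpositive, hence monotone, hence
    linear: for bounded homomorphisms homogeneity is automatic. *)
Lemma monoid_hom_le1_powR C g : convex_cone C -> monoid_hom_on C g ->
  (forall x, C x -> g x <= 1) ->
  forall t x, 0 < t -> C x -> g (t *: x) = g x `^ t.
Proof.
move=> CC ghom gle1 t x t0 Cx; have [C0 CD CZ] := CC; have [g0 g1 gD] := ghom.
have gDs s r : 0 <= s -> 0 <= r -> g ((s + r) *: x) = g (s *: x) * g (r *: x).
  by move=> s0 r0; rewrite scalerDl gD//; exact: CZ.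
have gn n s : 0 <= s -> g ((n%:R * s) *: x) = g (s *: x) ^+ n.
  move=> s0; rewrite -scalerA scaler_nat (monoid_hom_natmul _ CC ghom)//.
  exact: CZ.
have [gx0|gx0] := eqVneq (g x) 0.
  rewrite gx0 powR0 ?gt_eqF//.
  have /archi_boundP : 0 <= t^-1 by rewrite invr_ge0 ltW.
  set n := Num.bound _ => /ltW; rewrite -(ler_pM2r t0) mulVf ?gt_eqF// => nt.
  (* n * t >= 1, so the n-th power of g (t *: x) has the factor g x = 0 *)
  have := gn n t (ltW t0).
  rewrite -(subrK 1 (n%:R * t)) gDs ?ler01 ?subr_ge0// scale1r gx0 mulr0.
  by move=> /esym/eqP; rewrite expf_eq0 => /andP[_ /eqP].
have gpos s : 0 <= s -> 0 < g (s *: x).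
  move=> s0; rewrite lt_neqAle g0 ?andbT; last exact: CZ.
  have /archi_boundP := s0; set n := Num.bound _ => /ltW sn.
  have := gn n 1 ler01; rewrite mulr1 -(subrK s n%:R) gDs// ?subr_ge0//.
  apply: contra_eq_neq => /esym ->; rewrite mulr0 scale1r eq_sym.
  by rewrite expf_neq0.
have g1s s : 0 <= s -> g (s *: x) <= 1 by move=> s0; apply/gle1/CZ.
have := @bounded_additive_linear _ (fun s => ln (g (s *: x)))
  (- ln (g (2 *: x))).
move=> /(_ _ _ t t0); rewrite scale1r /powR (negbTE gx0) => <-.
- by rewrite lnK// posrE gpos// ltW.
- by move=> s r /ltW s0 /ltW r0; rewrite gDs// lnM ?posrE ?gpos.
move=> s /andP[s1 s2]; have s0 : 0 <= s by lra.
rewrite ler0_norm ?lerN2 ?ln_le0 ?g1s// ler_ln ?posrE ?gpos//.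
rewrite -(subrK s 2) gDs ?subr_ge0// ler_piMl ?g1s ?subr_ge0//.
by rewrite ltW// gpos.
Qed.

Lemma face_convex_cone C F : convex_cone C -> face_of (fun v u => p u v) F C ->
  convex_cone F.
Proof.
move=> [C0 CD CZ] [v vC ->]; split.
- by split => //=; rewrite linear0l.
- move=> x y [Cx /= xv] [Cy /= yv]; split; first exact: CD.
  by rewrite /= linearDl/= xv yv addr0.
- move=> t x t0 [Cx /= xv]; split; first exact: CZ.
  by rewrite /= pairingZl xv mulr0.
Qed.

Lemma val_continuous C :
  continuous (fun x : (C : set (vect_top M)) => \val x : vect_top M).
Proof. exact: initial_continuous. Qed.

(** On a face [F] there are two cases. If [g] has a zero in [F], then [g]
    vanishes on all of the relative interior: a segment from the zero to an
    interior point can be prolonged, which writes a multiple of the interior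
    point as a sum with a multiple of the zero. Otherwise [ln g] is linear on
    [F]. Both are continuous. *)
Lemma monoid_hom_homc C g : convex_cone C -> monoid_hom_on C g ->
  (forall t x, 0 < t -> C x -> g (t *: x) = g x `^ t) ->
  homc p C (fun x : C => g (\val x)).
Proof.
move=> CC ghom gZ; have [C0 CD CZ] := CC; have [g0 g1 gD] := ghom.
have valC (x : C) : C (\val x) by exact: set_valP.
split=> [x|z ->//|x y z ->|F FC]; [exact: g0|exact: gD|].
have FCC := face_convex_cone CC FC; have sFC := face_of_subset FC.
have [F0 FD FZ] := FCC.
have [[x Fx gx0]|gF0] := pselect (exists2 x, F x & g x = 0).
  apply: (@subspace_eq_continuous _ _ _ (cst 0)); last exact: cst_continuous.
  move=> y /set_mem/= yF; rewrite /cst/=.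
  have Fy : F (\val y) by case: yF.
  have [e e0 Fz] := relint_extend yF Fx.
  have := gD _ _ (sFC _ Fz) (CZ _ _ (ltW e0) (sFC _ Fx)).
  rewrite [X in _ = _ * X]gZ//; last exact: sFC.
  rewrite gx0 powR0 ?gt_eqF// mulr0 scalerBr addrA subrK.
  rewrite -[X in X + _]scale1r -scalerDl gZ ?addr_gt0//; last exact: sFC.
  by move=> /powR_eq0_eq0/esym.
have gF x : F x -> 0 < g x.
  move=> Fx; rewrite lt_neqAle g0 ?andbT; last exact: sFC.
  by apply/eqP => gx0; apply: gF0; exists x.
have [|t x t0 Fx|v vE] := @additive_on_cone_eq_pairing _ _ _ p F
    (fun x => ln (g x)) p_nondegenerate.1 FCC.
- by move=> x y Fx Fy; rewrite gD ?lnM ?posrE ?gF//; exact: sFC.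
- by rewrite gZ ?ln_powR//; exact: sFC.
apply: (@subspace_eq_continuous _ _ _
    (fun x : (C : set (vect_top M)) => expR (p (\val x) v))).
  move=> y /set_mem/= [Fy _]; rewrite -vE// lnK// posrE; exact: gF.
apply: continuous_subspaceT => x.
apply: continuous_comp; last exact: continuous_expR.
apply: (@continuous_comp _ _ _
  (fun x : (C : set (vect_top M)) => \val x : vect_top M)
  (fun u => p u v)); first exact: val_continuous.
by apply: linear_form_continuous => *; rewrite ?linearDl ?pairingZl.
Qed.

End MonoidHomomorphisms.

(** * Polyhedral cones and their duals *)

Section PolyhedralCones.
Context {R : realType} {M N : vectType R}.
Variable p : {bilinear M -> N -> R | *%R & *%R}.
Hypothesis p_nondegenerate : nondegenerate_pairing p.
Implicit Types (s T : set N) (C F : set M) (g : M -> R).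

Lemma dual_convex_cone s : convex_cone (dual_cone p s).
Proof.
split=> [v sv|x y sx sy v sv|t x t0 sx v sv].
- by rewrite linear0l.
- by rewrite linearDl/= addr_ge0 ?sx ?sy.
- by rewrite pairingZl mulr_ge0 ?sx.
Qed.

Lemma dual_coneS s T : T `<=` s -> dual_cone p s `<=` dual_cone p T.
Proof. by move=> Ts u su v /Ts; exact: su. Qed.

Lemma polyhedral_generators (V : vectType R) (s : set V) : polyhedral_cone s ->
  exists k (w : 'I_k -> V), (forall i, s (w i)) /\
    forall x, s x <-> exists2 a : 'I_k -> R, forall i, 0 <= a i &
      x = \sum_(i < k) a i *: w i.
Proof.
move=> [k [w ->]]; exists k, w; split => // i.
exists (fun j => (j == i)%:R); first by move=> j; rewrite ler0n.
rewrite (bigD1 i)//= eqxx scale1r big1 ?addr0// => j /negbTE ->.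
by rewrite scale0r.
Qed.

Lemma polyhedral_face s T : polyhedral_cone s -> face_of p T s ->
  polyhedral_cone T.
Proof.
move=> /polyhedral_generators[k [w [sw sE]]] [u su ->].
exists k, (fun i => if p u (w i) == 0 then w i else 0).
apply/seteqP; split=> [x [/sE[a a0 ->] /=]|_ [a a0 ->]].
  rewrite linear_sumr => au0; exists a => //; apply: eq_bigr => i _.
  case: ifPn => // uwi; have : p u (a i *: w i) = 0.
    by apply: (psumr_eq0P _ au0) => // j _; rewrite pairingZr mulr_ge0// su.
  by rewrite pairingZr => /eqP; rewrite mulf_eq0 (negbTE uwi) orbF => /eqP ->;
    rewrite !scale0r.
split=> /=.
  apply/sE; exists (fun i => if p u (w i) == 0 then a i else 0).
    by move=> i; case: ifP.
  by apply: eq_bigr => i _; case: ifP; rewrite ?scale0r ?scaler0.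
rewrite linear_sumr big1// => i _; rewrite pairingZr.
by case: ifPn => [/eqP ->|_]; rewrite ?linear0r ?mulr0.
Qed.

(** The sum of the generators lies in no proper face. *)
Lemma polyhedral_interior_point s : polyhedral_cone s ->
  exists2 w, s w & forall u, dual_cone p s u -> p u w = 0 ->
    forall v, s v -> p u v = 0.
Proof.
move=> /polyhedral_generators[k [w [sw sE]]]; exists (\sum_i w i).
  by apply/sE; exists (fun=> 1) => //; apply: eq_bigr => i _; rewrite scale1r.
move=> u su; rewrite linear_sumr => uw0 v /sE[a a0 ->].
rewrite linear_sumr big1// => i _; rewrite pairingZr.
suff -> : p u (w i) = 0 by rewrite mulr0.
by apply: (psumr_eq0P _ uw0) => // j _; exact: su.
Qed.

(** Contrapositive of [farkas]. *)
Lemma polyhedral_separation s v : polyhedral_cone s -> ~ s v ->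
  exists2 u, dual_cone p s u & p u v < 0.
Proof.
move=> /polyhedral_generators[k [w [sw sE]]] sv; apply: contrapT => nu.
apply/sv/sE/(farkas p_nondegenerate.2) => u uw.
rewrite leNgt; apply/negP => uv; apply: nu; exists u => // _ /sE[a a0 ->].
by rewrite linear_sumr sumr_ge0// => i _; rewrite pairingZr mulr_ge0.
Qed.

(** The dual of the face of [s] cut out by [u] is obtained from the dual of
    [s] by allowing subtraction of [u]: a generator that pairs negatively with
    [x] is outside the face, so it pairs positively with [u] and is repaired
    by a large multiple of [u]. *)
Lemma dual_cone_face_shift s u x : polyhedral_cone s -> dual_cone p s u ->
  dual_cone p (s `&` [set v | p u v = 0]) x ->
  exists n, dual_cone p s (x + u *+ n).
Proof.
move=> /polyhedral_generators[k [w [sw sE]]] su xT.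
pose m i := Num.bound (`|p x (w i)| / p u (w i)).
exists (\sum_i m i)%N => _ /sE[a a0 ->].
rewrite linear_sumr; apply: sumr_ge0 => i _; rewrite pairingZr mulr_ge0//.
rewrite linearDl linearMnl/=.
have [uw0|uw0] := eqVneq (p u (w i)) 0.
  by rewrite uw0 mul0rn addr0; apply: xT; split.
have uw : 0 < p u (w i) by rewrite lt_neqAle eq_sym uw0 su.
have /archi_boundP : 0 <= `|p x (w i)| / p u (w i) by rewrite divr_ge0// ltW.
rewrite ltr_pdivrMr// mulr_natl -/(m i) => mi.
have mS : p u (w i) *+ m i <= p u (w i) *+ \sum_j m j.
  by rewrite ler_pMn2l// (bigD1 i)//= leq_addr.
have := ler_norm (- p x (w i)); rewrite normrN; lra.
Qed.

End PolyhedralCones.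

(** * The points of a chart *)

Section OrbitDecomposition.
Context {R : realType} {M N : vectType R}.
Variable p : {bilinear M -> N -> R | *%R & *%R}.
Hypothesis p_nondegenerate : nondegenerate_pairing p.
Implicit Types (s T : set N) (C F : set M) (g : M -> R).

(** [T] selects a torus orbit and [v] the position in it. For [T = set0] it
    is the point of the open orbit given by the one-parameter group of [v] at
    time one. The same formula on [M] restricts to every chart whose cone
    contains [T], which makes the gluing transparent. *)
Definition orbit_point T v x : R :=
  if `[< forall t, T t -> p x t = 0 >] then expR (- p x v) else 0.

Lemma orbit_pointE T v x : (forall t, T t -> p x t = 0) ->
  orbit_point T v x = expR (- p x v).
Proof. by move=> xT; rewrite /orbit_point asboolT. Qed.

Lemma orbit_point0 T v x : ~ (forall t, T t -> p x t = 0) ->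
  orbit_point T v x = 0.
Proof. by move=> xT; rewrite /orbit_point asboolF. Qed.

Lemma orbit_point_monoid_hom s T v : T `<=` s ->
  monoid_hom_on (dual_cone p s) (orbit_point T v).
Proof.
move=> Ts; split=> [x _||x y sx sy].
- by rewrite /orbit_point; case: ifP => // _; exact: expR_ge0.
- by rewrite orbit_pointE => [|t _]; rewrite linear0l// oppr0 expR0.
have [xT|xT] := pselect (forall t, T t -> p x t = 0); last first.
  rewrite (orbit_point0 _ xT) mul0r orbit_point0// => xyT; apply: xT => t Tt.
  have := xyT t Tt; rewrite linearDl/= => /eqP.
  by rewrite paddr_eq0 ?sx ?sy//; try exact: Ts; move=> /andP[/eqP].
have [yT|yT] := pselect (forall t, T t -> p y t = 0); last first.
  rewrite (orbit_point0 _ yT) mulr0 orbit_point0// => xyT; apply: yT => t Tt.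
  by have := xyT t Tt; rewrite linearDl/= xT// add0r.
rewrite !orbit_pointE// ?linearDl/= ?opprD ?expRD// => t Tt.
by rewrite linearDl/= xT// yT// addr0.
Qed.

Lemma orbit_point_homc s T v : T `<=` s ->
  homc p (dual_cone p s) (fun x : dual_cone p s => orbit_point T v (\val x)).
Proof.
move=> Ts; apply: monoid_hom_homc => //; first exact: dual_convex_cone.
  exact: orbit_point_monoid_hom.
move=> t x t0 sx; have [xT|xT] := pselect (forall y, T y -> p x y = 0).
  have txT y : T y -> p (t *: x) y = 0.
    by move=> /xT xy; rewrite pairingZl xy mulr0.
  by rewrite !orbit_pointE// pairingZl -mulrN mulrC expRM.
rewrite !orbit_point0// ?powR0 ?gt_eqF// => txT; apply: xT => y Ty.
have /eqP := txT _ Ty; rewrite pairingZl mulf_eq0 gt_eqF//=.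
by move/eqP.
Qed.

Lemma homc_extension C (f : C -> R) : exists g, f = fun x : C => g (\val x).
Proof.
exists (fun x => if insub x is Some y then f y else 0).
by apply/funext => x; rewrite valK.
Qed.

Lemma homc_monoid_hom C g : convex_cone C ->
  homc p C (fun x : C => g (\val x)) -> monoid_hom_on C g.
Proof.
move=> [C0 CD CZ] [g0 g1 gD _].
have CE := @exists_set_val _ C.
split=> [x /CE[y <-]||x y Cx Cy]; first exact: g0.
  by have [y y0] := CE _ C0; have := g1 y y0; rewrite y0.
have [z' z'E] := CE _ (CD _ _ Cx Cy); have [x' x'E] := CE _ Cx.
have [y' y'E] := CE _ Cy.
by have := gD x' y' z'; rewrite x'E y'E z'E; exact.
Qed.

(** Along a ray in the relative interior of a face, [ln g] is additive and,
    being continuous, bounded on the segment between [z] and [2 *: z]. *)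
Lemma homc_ray_linear C F g z : convex_cone C ->
  homc p C (fun x : C => g (\val x)) -> face_of (fun v u => p u v) F C ->
  (forall t, 0 < t -> relint F (t *: z)) ->
  (forall t, 0 < t -> 0 < g (t *: z)) ->
  forall t, 0 < t -> ln (g (t *: z)) = t * ln (g z).
Proof.
move=> CC gC FC zF gpos; have [_ CD CZ] := CC.
have [_ _ gD] := homc_monoid_hom CC gC.
have zC t : 0 < t -> C (t *: z) by move=> /zF[/(face_of_subset FC)].
have gcont : {within `[1, 2], continuous (fun t => g (t *: z))}.
  apply/subspace_continuousP => t /=; rewrite in_itv/= => /andP[t1 _] U nU.
  have t0 : 0 < t by rewrite (lt_le_trans ltr01).
  pose y : C := exist _ (t *: z) (mem_set (zC _ t0)).
  have [_ _ _ /(_ F FC)/subspace_continuousP/(_ y (zF _ t0) U nU)] := gC.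
  move=> [_ [[W oW <-] Wy WU]].
  have : \forall r \near t, W (r *: z).
    have := @affine_curve_continuous _ _ 0 z t W.
    rewrite add0r (_ : (fun r => 0 + r *: z) = *:%R^~ z); last first.
      by apply/funext => r; rewrite add0r.
    by apply; exact: (open_nbhs_nbhs (conj oW Wy)).
  move=> Wt; suff : \forall r \near t, (1 <= r <= 2) -> U (g (r *: z)) by [].
  apply: filterS Wt => r Wr /andP[r1 _].
  have r0 : 0 < r by rewrite (lt_le_trans ltr01).
  exact: (WU (exist _ (r *: z) (mem_set (zC _ r0))) Wr (zF _ r0)).
have /EVT_max[//|a a12 gmax] := gcont; first by lra.
have /EVT_min[//|b b12 gmin] := gcont; first by lra.
have itv12 (t : R) : t \in `[1, 2] -> 0 < t by rewrite in_itv/=; lra.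
move=> t t0; rewrite (@bounded_additive_linear _ (fun t => ln (g (t *: z)))
    (`|ln (g (a *: z))| + `|ln (g (b *: z))|) _ _ t t0) ?scale1r//.
  move=> r r' r0 r'0; rewrite scalerDl gD ?lnM ?posrE ?gpos//; exact: zC.
move=> r r12; have rin : r \in `[1, 2] by rewrite in_itv.
have lea : ln (g (r *: z)) <= ln (g (a *: z)).
  by rewrite ler_ln ?posrE ?gpos ?gmax// itv12.
have leb : ln (g (b *: z)) <= ln (g (r *: z)).
  by rewrite ler_ln ?posrE ?gpos ?gmin// itv12.
have := ler_norm (ln (g (a *: z))); have := ler_norm (- ln (g (b *: z))).
have := normr_ge0 (ln (g (a *: z))); have := normr_ge0 (ln (g (b *: z))).
by rewrite normrN ler_norml; lra.
Qed.

(** Continuity is only known on the relative interior, so homogeneity of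
    [ln g] at a point [x] of the boundary is obtained by comparing the rays
    through [y] and [y + x], where [y] is a relative interior point. *)
Lemma homc_face_log_linear C F g : convex_cone C ->
  homc p C (fun x : C => g (\val x)) -> face_of (fun v u => p u v) F C ->
  (forall x, F x -> 0 < g x) ->
  exists v, forall x, F x -> g x = expR (- p x v).
Proof.
move=> CC gC FC gpos; have FCC := face_convex_cone CC FC.
have sFC := face_of_subset FC; have [F0 FD FZ] := FCC.
have [_ _ gD] := homc_monoid_hom CC gC.
have [b [bfree bF Fb]] := exists_free_spanning F.
pose y := \sum_(i < size b) 1 *: b`_i.
have tyE t : t *: y = \sum_(i < size b) t *: b`_i.
  by rewrite scaler_sumr; apply: eq_bigr => i _; rewrite scale1r.
have Fy : F y.
  by apply: convex_cone_sum => // i; apply: bF; exact: mem_nth.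
have lnD z z' : F z -> F z' -> ln (g (z + z')) = ln (g z) + ln (g z').
  by move=> Fz Fz'; rewrite gD ?lnM ?posrE ?gpos//; exact: sFC.
have ray x t : F x -> 0 < t ->
    ln (g (t *: (y + x))) = t * ln (g (y + x)).
  move=> Fx t0; apply: (homc_ray_linear CC gC FC) => // r r0.
    rewrite scalerDr tyE; apply: relint_positive_combination => //.
    by apply: FZ => //; exact: ltW.
  by apply/gpos/FZ; [exact: ltW|exact: FD].
have lnZ t x : 0 < t -> F x -> ln (g (t *: x)) = t * ln (g x).
  move=> t0 Fx; have FtX z : F z -> F (t *: z) by apply: FZ; exact: ltW.
  have := ray x t Fx t0; have := ray 0 t F0 t0.
  by rewrite addr0 scalerDr !lnD// ?FtX//; [lra|exact: FtX|exact: FtX].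
have [|t x t0 Fx|v vE] := @additive_on_cone_eq_pairing _ _ _ p F
    (fun x => - ln (g x)) p_nondegenerate.1 FCC.
- by move=> z z' Fz Fz'; rewrite lnD// opprD.
- by rewrite lnZ// mulrN.
by exists v => x Fx; rewrite -vE// opprK lnK// posrE gpos.
Qed.

(** The support of [f] is a face of the dual cone, namely the one orthogonal
    to a face [T] of [s], and [ln f] is linear there. To find [T], choose
    [u0] in the support that pairs positively with every generator of [s] on
    which the support does not vanish, and let [u0] cut out [T]. *)
Lemma homc_orbit_point s (f : dual_cone p s -> R) : polyhedral_cone s ->
  homc p (dual_cone p s) f ->
  exists T v, face_of p T s /\
    forall x : dual_cone p s, f x = orbit_point T v (\val x).
Proof.
move=> spoly; have [g ->] := homc_extension f => gC.
set C := dual_cone p s in f gC *.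
have CC : convex_cone C by exact: dual_convex_cone.
have ghom := homc_monoid_hom CC gC; have [g0 g1 gD] := ghom.
have [C0 CD CZ] := CC.
have [k [w [sw sE]]] := polyhedral_generators spoly.
have gen i : exists u, [/\ C u, 0 < g u & forall u', C u' -> 0 < g u' ->
    p u' (w i) != 0 -> 0 < p u (w i)].
  have [[u [Cu gu uw]]|nu] :=
    pselect (exists u, [/\ C u, 0 < g u & p u (w i) != 0]).
    by exists u; split=> // *; rewrite lt_neqAle eq_sym uw Cu.
  exists 0; split => //; first by rewrite g1.
  by move=> u Cu gu uw; case: nu; exists u.
have {gen}[u uE] := choice gen; pose u0 := \sum_i u i.
have [Cu0 gu0] : C u0 /\ 0 < g u0.
  apply: (big_ind (fun x => C x /\ 0 < g x)) => [|x y [Cx gx] [Cy gy]|i _].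
  - by rewrite g1.
  - by split; [exact: CD|rewrite gD// mulr_gt0].
  - by case: (uE i).
pose T := s `&` [set v | p u0 v = 0].
have TF : face_of p T s by exists u0.
have Tpoly := polyhedral_face spoly TF.
have sT : T `<=` s by move=> x [].
(* a generator of s in T is orthogonal to u0, hence to the whole support by the
   choice of u0 *)
have support_perp x : C x -> 0 < g x -> forall t, T t -> p x t = 0.
  move=> Cx gx _ [/sE[a a0 ->]] /=; rewrite !linear_sumr/= => au0.
  rewrite big1// => i _; have : p u0 (a i *: w i) = 0.
    by apply: (psumr_eq0P _ au0) => // j _; rewrite pairingZr mulr_ge0// Cu0.
  rewrite !pairingZr => /eqP; rewrite mulf_eq0 => /orP[/eqP ->|uw].
    by rewrite mul0r.
  have [->|xw] := eqVneq (p x (w i)) 0; first by rewrite mulr0.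
  have [_ _ /(_ x Cx gx xw)] := uE i.
  suff -> : p (u i) (w i) = 0 by rewrite ltxx.
  move: uw; rewrite linear_sumlz => /eqP uw.
  by apply: (psumr_eq0P _ uw) => // j _; have [Cuj _ _] := uE j; exact: Cuj.
(* x is a summand of a multiple of u0, at which g is positive *)
have perp_support x : C x -> (forall t, T t -> p x t = 0) -> 0 < g x.
  move=> Cx xT.
  have [|n Cn] := @dual_cone_face_shift _ _ _ p s u0 (- x) spoly Cu0.
    by move=> v /xT xv; rewrite linearNl xv oppr0.
  rewrite lt_neqAle g0 ?andbT//; apply/eqP => gx0.
  have := gD _ _ Cx Cn; rewrite -gx0 mul0r addNKr.
  rewrite (monoid_hom_natmul _ CC ghom)// => /eqP.
  by rewrite expf_eq0 gt_eqF// andbF.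
(* w0 exhibits the support as an exposed face F of C *)
have [w0 Tw0 w0E] := polyhedral_interior_point p Tpoly.
pose F := C `&` [set x | p x w0 = 0].
have FC : face_of (fun v u => p u v) F C.
  by exists w0 => // x; apply; exact: sT.
have FE x : F x -> forall t, T t -> p x t = 0.
  by move=> [Cx /= xw0]; apply: w0E => //; exact: dual_coneS Cx.
have gF x : F x -> 0 < g x.
  by move=> /[dup] Fx [Cx _]; apply: perp_support => //; exact: FE.
have [v vE] := homc_face_log_linear CC gC FC gF.
exists T, v; split => // x; have Cx : C (\val x) by exact: set_valP.
have [xT|xT] := pselect (forall t, T t -> p (\val x) t = 0).
  by rewrite orbit_pointE// vE//; split => //=; exact: xT.
rewrite orbit_point0//; apply/eqP; rewrite eq_le g0// andbT leNgt.
by apply/negP => /(support_perp _ Cx).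
Qed.

End OrbitDecomposition.

(** * The glued variety and its compact pieces *)

Section Variety.
Context {R : realType} {M N : vectType R}.
Variable p : {bilinear M -> N -> R | *%R & *%R}.
Hypothesis p_nondegenerate : nondegenerate_pairing p.
Variable Sigma : set (set N).
Local Notation Y := (irrational_toric_variety p Sigma).

Definition toric_pi (a : charts p Sigma) : Y := \pi_Y a.

Lemma toric_pi_surj y : exists a, y = toric_pi a.
Proof. by exists (repr y); rewrite /toric_pi reprK. Qed.

Lemma toric_pi_continuous : continuous toric_pi.
Proof. exact: pi_continuous. Qed.

Lemma toric_piP a b :
  toric_pi a = toric_pi b <->
  Relation_Operators.clos_refl_sym_trans _ (@Defs.glue _ _ _ p Sigma) a b.
Proof.
split=> [/eqmodP/asboolP//|ab]; apply/eqmodP; exact/asboolP.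
Qed.

Lemma glue_toric_pi a b : Defs.glue a b -> toric_pi a = toric_pi b.
Proof. by move=> ab; apply/toric_piP/Relation_Operators.rst_step. Qed.

(** Sets of points of charts that are unions of gluing classes. *)
Definition glue_invariant (W : set (charts p Sigma)) :=
  forall a b, Defs.glue a b -> W a <-> W b.

Lemma glue_invariant_toric_pi W a b : glue_invariant W ->
  toric_pi a = toric_pi b -> W a -> W b.
Proof.
move=> Winv /toric_piP ab; suff : W a <-> W b by move=> [].
elim: ab => [x y /Winv//|//|x y _ [? ?]|x y z _ [xy yx] _ [yz zy]].
  by split.
by split=> [/xy/yz|/zy/yx].
Qed.

(** The preimage in each chart of the image of a glue-invariant set is the set
    itself. *)
Lemma closed_toric_image W : glue_invariant W ->
  (forall s : Sigma, closed [set f : chart p (\val s) | W (existT _ s f)]) ->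
  closed (toric_pi @` W).
Proof.
move=> Winv Wcl; rewrite -[_ @` _]setCK; apply: open_closedC.
suff : open (toric_pi @^-1` (~` (toric_pi @` W))) by [].
rewrite (_ : _ @^-1` _ = ~` W); last first.
  apply/seteqP; split=> a /= Wa; first by move=> ?; apply: Wa; exists a.
  move=> [b Wb ba]; apply: Wa; exact: (glue_invariant_toric_pi Winv ba Wb).
by apply/sigT_openP => s; apply: closed_openC; exact: Wcl.
Qed.

Definition orbit_chart (s : Sigma) T v (Ts : T `<=` \val s) : charts p Sigma :=
  existT (fun s : Sigma => chart p (\val s)) s
    (exist (fun f => f \in homc p (dual_cone p (\val s))) _
      (mem_set (orbit_point_homc p_nondegenerate v Ts))).

Lemma glue_orbit_chart (s t : Sigma) T v (Ts : T `<=` \val s)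
    (Tt : T `<=` \val t) :
  face_of p (\val t) (\val s) ->
  Defs.glue (orbit_chart v Tt) (orbit_chart v Ts).
Proof. by move=> ts; split => //= x y ->. Qed.

Lemma eq_orbit_chart (s : Sigma) T v (Ts : T `<=` \val s)
    (f : chart p (\val s)) :
  (forall x, \val f x = orbit_point p T v (\val x)) ->
  existT _ s f = orbit_chart v Ts.
Proof. by move=> fE; congr existT; apply/val_inj/funext. Qed.

(** Tychonoff: homomorphisms into [0, 1] form a closed subset of a product of
    unit intervals, because the continuity requirement, which is not a closed
    condition, holds automatically for them. *)
Lemma bounded_chart_compact s :
  compact [set f : chart p s | forall x, \val f x <= 1].
Proof.
set C := dual_cone p s; have CC : convex_cone C by exact: dual_convex_cone.
have [C0 CD CZ] := CC.
pose K := [set f : {ptws C -> R} | [/\ forall x, 0 <= f x <= 1,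
  forall z : C, \val z = 0 -> f z = 1 &
  forall x y z : C, \val z = \val x + \val y -> f z = f x * f y]].
have Khomc f : K f -> homc p C f.
  move=> [f01 f1 fD]; have [g gE] := homc_extension f.
  have fg x : C x -> exists2 y : C, \val y = x & f y = g x.
    by move=> /(@exists_set_val _ C)[y <-]; exists y; rewrite // gE.
  have ghom : monoid_hom_on C g.
    split=> [x /fg[y _ <-]||x y Cx Cy]; first by case/andP: (f01 y).
      by have [y y0 <-] := fg _ C0; exact: f1.
    have [z zE <-] := fg _ (CD _ _ Cx Cy); have [x' xE <-] := fg _ Cx.
    by have [y' yE <-] := fg _ Cy; apply: fD; rewrite zE xE yE.
  rewrite gE; apply: monoid_hom_homc => // t x t0 Cx.
  apply: (monoid_hom_le1_powR CC ghom) => // {t t0 Cx}y /fg[y' _ <-].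
  by case/andP: (f01 y').
have ev_cont (x : C) : continuous (fun f : {ptws C -> R} => f x).
  exact: proj_continuous.
have closedP (P : Prop) (A : set {ptws C -> R}) : closed A ->
    closed [set f | P -> A f].
  have [HP|nP] := pselect P => Acl.
    rewrite (_ : mkset _ = A)//; apply/seteqP; split=> f /=; first exact.
    by move=> Af _.
  rewrite (_ : mkset _ = setT); first exact: closedT.
  by apply/seteqP; split=> f //= _ HP; case: (nP HP).
have closed_forall I (A : I -> set {ptws C -> R}) : (forall i, closed (A i)) ->
    closed [set f | forall i, A i f].
  move=> Acl; rewrite (_ : mkset _ = \bigcap_i A i); first exact: closed_bigI.
  by apply/seteqP; split=> [f Af i _|f Af i]; exact: Af.
pose cube := [set f : {ptws C -> R} |
  forall x, (`[0, 1]%classic : set R) (f x)].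
have Kcompact : compact K.
  apply: (@subclosed_compact _ _ cube).
  - have KE : K = cube `&`
        [set f : {ptws C -> R} | forall z : C, \val z = 0 -> f z = 1] `&`
        [set f : {ptws C -> R} | forall x y z : C, \val z = \val x + \val y ->
          f z = f x * f y].
      apply/seteqP; split=> f.
        move=> [f01 f1 fD]; split; [split|] => /=.
        - by move=> x /=; rewrite in_itv/=; exact: f01.
        - exact: f1.
        - exact: fD.
      by move=> [[/= f01 f1] fD]; split.
    rewrite KE; apply: closedI; [apply: closedI|].
    + apply: closed_forall => x.
      apply: (@preimage_closed _ _ (fun f : {ptws C -> R} => f x)).
        by move=> f _; exact: ev_cont.
      exact: itv_closed.
    + apply: closed_forall => z; apply: closedP.
      apply: (@closed_equalizer R _ (fun f : {ptws C -> R} => f z) (fun=> 1)).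
        exact: ev_cont.
      exact: cst_continuous.
    + apply: (closed_forall) => x; apply: (closed_forall) => y.
      apply: closed_forall => z; apply: closedP.
      apply: (@closed_equalizer R _ (fun f : {ptws C -> R} => f z)
        (fun f : {ptws C -> R} => f x * f y)); first exact: ev_cont.
      by move=> f; apply: continuousM; exact: ev_cont.
  - have cpt01 : compact (`[0, 1]%classic : set R) by exact: segment_compact.
    exact: (@tychonoff _ (fun _ : C => R : topologicalType)
      (fun=> `[0, 1]%classic) (fun=> cpt01)).
  - by move=> f Kf x; have [f01 _ _] := Kf; rewrite /= in_itv/=; exact: f01.
(* compactness in the product passes to the chart, which carries the induced
   topology *)
move=> F FF FK.
pose incl (g : chart p s) : {ptws C -> R} := \val g.
have KF : F (incl @^-1` K).
  apply: filterS FK => g g1; have [g0 gE gD _] := set_valP g.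
  by split=> // x; rewrite g0 g1.
have [f [Kf Ff]] := Kcompact (incl @ F) _ KF.
have fin : f \in homc p C by apply/mem_set/Khomc.
exists (exist _ f fin); split; first by move=> x; case: Kf => /(_ x)/andP[].
move=> A B FA [_ [[W oW <-] Wf WB]].
have FA' : F (incl @^-1` (incl @` A)) by apply: filterS FA => g Ag; exists g.
have [_ [[g Ag <-] Wg]] := Ff _ _ FA' (open_nbhs_nbhs (conj oW Wf)).
by exists g; split => //; exact: WB.
Qed.

End Variety.

(** * The variety of a complete fan *)

Section Compactness.
Context {R : realType} {M N : vectType R}.
Variable p : {bilinear M -> N -> R | *%R & *%R}.
Hypothesis p_nondegenerate : nondegenerate_pairing p.
Variable Sigma : set (set N).
Hypothesis Sigma_fan : fan p Sigma.
Local Notation Y := (irrational_toric_variety p Sigma).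

Implicit Types (s t : set N) (v w : N).

(** Pigeonhole: finitely many cones contain all the points [v + w *+ n].
    *)
Lemma complete_fan_cofinal v w : complete_fan Sigma ->
  exists2 s, Sigma s & forall m, exists2 n, (m <= n)%N & s (v + w *+ n).
Proof.
move=> complete; have [Sfin _ _ _] := Sigma_fan; apply: contrapT => none.
have : \forall n \near \oo, forall s, s \in fset_set Sigma -> ~ s (v + w *+ n).
  apply: filter_bigI => s; rewrite in_fset_set// inE => Ss.
  apply: contrapT => ns; apply: none; exists s => // m.
  apply: contrapT => nm; apply: ns; exists m => // n /= mn sn.
  by apply: nm; exists n.
move=> [n _ /(_ n (leqnn n)) nS]; have [s Ss sv] := complete (v + w *+ n).
by apply: (nS s) sv; rewrite in_fset_set// inE.
Qed.

(** The points [(v + w *+ n) / n] of [s] tend to [w]; the proof tests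
    this on the functionals that are nonnegative on [s]. *)
Lemma cofinal_ray_direction s v w : polyhedral_cone s ->
  (forall m, exists2 n, (m <= n)%N & s (v + w *+ n)) -> s w.
Proof.
move=> spoly cof; apply: contrapT.
move=> /(polyhedral_separation p_nondegenerate spoly)[u su uw].
have /archi_boundP : 0 <= `|p u v| / - p u w.
  by rewrite divr_ge0// oppr_ge0 ltW.
set m := Num.bound _; rewrite ltr_pdivrMr ?oppr_gt0// => mlt.
have [n mn /su] := cof m; rewrite linearDr linearMnr/=.
have : p u w *+ n <= p u w *+ m by rewrite ler_nMn2l.
by have := ler_norm (p u v); rewrite mulrN mulr_natl in mlt; lra.
Qed.

(** The intersection of [s] and [t] is a face of [t] that contains an interior
    point of [t], so it is [t]; and it is also a face of [s]. *)
Lemma face_of_sub_interior s t w : Sigma s -> Sigma t ->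
  (forall u, dual_cone p t u -> p u w = 0 -> forall v, t v -> p u v = 0) ->
  t w -> s w -> face_of p t s.
Proof.
move=> Ss St wE tw sw; have [_ _ _ /(_ _ _ St Ss)[[u tu tsE] tss]] := Sigma_fan.
suff -> : t = t `&` s by [].
have uw : p u w = 0 by have : (t `&` s) w by []; rewrite tsE => -[].
by rewrite tsE; apply/seteqP; split=> [v tv|v []//]; split => //=; exact: wE tv.
Qed.

(** Write the point as [orbit_point T v]. Moving [v] in the direction of an
    interior point [w] of [T] does not change the point, and for large
    multiples [v + w *+ n] lies in a cone [t] of the fan that has [T] as a
    face. In the chart of [t] the values of the point are the exponentials of
    [- p x (v + w *+ n)], with [x] in the dual of [t], or zero. *)
Lemma complete_bounded_representative (a : charts p Sigma) :
  complete_fan Sigma -> exists (s : Sigma) (f : chart p (\val s)),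
    (forall x, \val f x <= 1) /\ toric_pi a = toric_pi (existT _ s f).
Proof.
move=> complete; have [_ Spoly Sface _] := Sigma_fan; case: a => s f.
have Ss : Sigma (\val s) by exact: set_valP.
have [T [v [TF fE]]] :=
  homc_orbit_point p_nondegenerate (Spoly _ Ss) (set_valP f).
have ST := Sface _ _ Ss TF.
have [w Tw wE] := polyhedral_interior_point p (Spoly _ ST).
have [t St cof] := complete_fan_cofinal v w complete.
have tw := cofinal_ray_direction (Spoly _ St) cof.
have Tt := face_of_sub_interior St ST wE Tw tw.
have [n _ tvn] := cof 0%N; pose v' := v + w *+ n.
pose t' : Sigma := exist _ t (mem_set St).
pose T' : Sigma := exist _ T (mem_set ST).
have sTs : T `<=` \val s by exact: face_of_subset TF.
have sTt : T `<=` \val t' by exact: face_of_subset Tt.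
have sTT : T `<=` \val T' by [].
have vE x : orbit_point p T v x = orbit_point p T v' x.
  have [xT|xT] := pselect (forall y, T y -> p x y = 0).
    by rewrite !orbit_pointE// linearDr linearMnr/= (xT w)// mul0rn addr0.
  by rewrite !orbit_point0.
have -> : existT _ s f = orbit_chart p_nondegenerate v' sTs.
  by apply: eq_orbit_chart => x; rewrite fE vE.
rewrite -(glue_toric_pi (glue_orbit_chart p_nondegenerate v' sTs sTT TF)).
rewrite (glue_toric_pi (glue_orbit_chart p_nondegenerate v' sTt sTT Tt)).
exists t', (projT2 (orbit_chart p_nondegenerate v' sTt)); split => //= x.
have tx : dual_cone p t (\val x) by exact: set_valP.
rewrite /orbit_point; case: ifP => // _.
by rewrite expR_le1 oppr_le0; exact: tx.
Qed.

Lemma complete_compact : complete_fan Sigma -> compact [set: Y].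
Proof.
move=> complete; have [Sfin _ _ _] := Sigma_fan.
pose K (s : Sigma) : set Y := (fun f => toric_pi (existT _ s f)) @`
  [set f : chart p (\val s) | forall x, \val f x <= 1].
have Kcompact (s : Sigma) : compact (K s).
  apply: continuous_compact; last exact: bounded_chart_compact.
  apply: continuous_subspaceT => f.
  apply: (@continuous_comp _ _ _
    (existT (fun s : Sigma => chart p (\val s)) s) (@toric_pi _ _ _ p Sigma)).
    exact: existT_continuous.
  exact: toric_pi_continuous.
have -> : [set: Y] = \bigcup_s K s.
  apply/seteqP; split=> // y _; have [a ->] := toric_pi_surj y.
  by have [s [f [f1 ->]]] := complete_bounded_representative a complete;
    exists s => //; exists f.
have finS : finite_set [set: Sigma].
  by have /eq_finite_set -> := card_setT Sigma.
rewrite -fsbig_setU//; apply: big_rec => [|i X _]; first exact: compact0.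
exact: compactU.
Qed.

(** * The variety of an incomplete fan *)

(** The points at times [r >= m] of the one-parameter group of [v]. The
    parameter is real because a closed half-line in the chart is easier to
    recognise from its equations than a discrete subset of it. *)
Definition ray_tail v (m : nat) (a : charts p Sigma) : Prop :=
  exists2 r : R, m%:R <= r &
    forall x : dual_cone p (\val (projT1 a)),
      \val (projT2 a) x = expR (- (r * p (\val x) v)).

(** A homomorphism on the dual of a face is determined by its restriction to
    the smaller dual cone as soon as that restriction is positive, by
    [dual_cone_face_shift]. *)
Lemma glue_invariant_ray_tail v m : glue_invariant (ray_tail v m).
Proof.
have [_ Spoly _ _] := Sigma_fan.
move=> [t f] [s g] [/= ts fg].
have Ss : Sigma (\val s) by exact: set_valP.
have sub x : dual_cone p (\val s) x -> dual_cone p (\val t) x.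
  by apply: dual_coneS; exact: face_of_subset ts.
split=> -[r mr rE]; exists r => // x /=.
  have sx : dual_cone p (\val s) (\val x) by exact: set_valP.
  by have [y yE] := exists_set_val (sub _ sx); rewrite (fg x y)// rE yE.
have [_ _ fD _] := set_valP f.
have tx : dual_cone p (\val t) (\val x) by exact: set_valP.
case: ts => u su tE.
have [|n sn] := @dual_cone_face_shift _ _ _ p _ _ (\val x) (Spoly _ Ss) su.
  by rewrite -tE.
have [_ CD CZ] := dual_convex_cone p (\val s).
have snu : dual_cone p (\val s) (u *+ n).
  by rewrite -scaler_nat; apply: CZ.
have [z zE] := exists_set_val sn; have [z' z'E] := exists_set_val (sub _ sn).
have [y yE] := exists_set_val snu; have [y' y'E] := exists_set_val (sub _ snu).
have fz' : \val f z' = expR (- (r * p (\val x + u *+ n) v)).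
  by rewrite -zE -[RHS]rE; apply/esym/fg; rewrite zE z'E.
have fy' : \val f y' = expR (- (r * p (u *+ n) v)).
  by rewrite -yE -[RHS]rE; apply/esym/fg; rewrite yE y'E.
have : \val f z' = \val f x * \val f y' by apply: fD; rewrite z'E y'E.
rewrite fz' fy' linearDl/= mulrDr opprD expRD => /mulIf/esym; apply.
by rewrite gt_eqF// expR_gt0.
Qed.

(** A functional [u] in the dual cone with [p u v < 0] recovers the
    parameter [r] continuously from the value at [u], which is at least
    [expR (- (m%:R * p u v))] on the set. So the set is given by the
    inequality and by equations that are continuous in the point. *)
Lemma closed_ray_tail v m (s : Sigma) : ~ \val s v ->
  closed [set f : chart p (\val s) | ray_tail v m (existT _ s f)].
Proof.
have [_ Spoly _ _] := Sigma_fan.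
have Ss : Sigma (\val s) by exact: set_valP.
move=> /(polyhedral_separation p_nondegenerate (Spoly _ Ss))[u su uv].
pose u' : dual_cone p (\val s) := exist _ u (mem_set su).
have ev_cont (x : dual_cone p (\val s)) :
    continuous (fun f : chart p (\val s) => \val f x).
  move=> f; apply: (@continuous_comp _ _ _ (fun f : chart p (\val s) => \val f)
    (fun f : {ptws dual_cone p (\val s) -> R} => f x)).
    exact: initial_continuous.
  exact: proj_continuous.
move=> f fcl.
have fm : expR (- (m%:R * p u v)) <= \val f u'.
  rewrite leNgt; apply/negP => flt.
  pose b := expR (- (m%:R * p u v)).
  have [|g [[r mr /(_ u')/= gE]]] := fcl [set g | \val g u' < b].
    apply: (ev_cont u' f [set r | r < b]).
    by apply: open_nbhs_nbhs; split => //; exact: open_lt.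
  by rewrite /= gE /b ltr_expR ltrN2 ltr_nM2r// ltNge mr.
have f0 : 0 < \val f u' by apply: lt_le_trans fm; exact: expR_gt0.
pose r (g : chart p (\val s)) := ln (\val g u') / - p u v.
exists (r f).
  by rewrite /r ler_pdivlMr ?oppr_gt0// mulrN -ler_expR lnK.
move=> /= x; apply/eqP; rewrite -subr_eq0; apply/contraT => fx.
pose h (g : chart p (\val s)) := \val g x - expR (- (r g * p (\val x) v)).
have hf : h g @[g --> f] --> h f.
  have evu : \val g u' @[g --> f] --> \val f u' by exact: ev_cont.
  have evx : \val g x @[g --> f] --> \val f x by exact: ev_cont.
  have lnu : ln (\val g u') @[g --> f] --> ln (\val f u').
    exact: (cvg_comp _ _ evu (continuous_ln f0)).
  have ru : - (r g * p (\val x) v) @[g --> f] --> - (r f * p (\val x) v).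
    exact: (cvgN (cvgMr_tmp (cvgMr_tmp lnu))).
  have eu : expR (- (r g * p (\val x) v)) @[g --> f] -->
      expR (- (r f * p (\val x) v)).
    exact: (cvg_comp _ _ ru (@continuous_expR R _)).
  exact: (cvgB evx eu).
have [|g [[r' mr' gE]]] := fcl (h @^-1` [set y | y != 0]).
  by apply: hf; apply: open_nbhs_nbhs; split => //; exact: open_neq.
have rg : r g = r'.
  by rewrite /r (gE u') /= expRK -mulrN mulfK// oppr_eq0 lt_eqF.
by rewrite /= /h rg (gE x) subrr eqxx.
Qed.

(** If [v] lies in no cone, the points of the one-parameter group of [v] at
    integer times have no cluster point: such a point would lie in all the
    closed sets [ray_tail v m], so its value at a separating functional of
    its chart would exceed every bound. *)
Lemma compact_complete : Sigma !=set0 -> compact [set: Y] -> complete_fan Sigma.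
Proof.
move=> [s0 Ss0] Ycompact v; apply: contrapT => nv.
have [_ Spoly _ _] := Sigma_fan.
have sv (s : Sigma) : ~ \val s v.
  by move=> sv; apply: nv; exists (\val s) => //; exact: set_valP.
pose s0' : Sigma := exist _ s0 (mem_set Ss0).
pose a (n : nat) : charts p Sigma :=
  orbit_chart p_nondegenerate (n%:R *: v) (sub0set (\val s0')).
have aE n m : (m <= n)%N -> ray_tail v m (a n).
  move=> mn; exists n%:R; first by rewrite ler_nat.
  by move=> x; rewrite /= orbit_pointE// pairingZr.
have [y [_ ycl]] := Ycompact ((fun n => toric_pi (a n)) @ \oo) _ filterT.
have [[s f] yE] := toric_pi_surj y.
have tail m : ray_tail v m (existT _ s f).
  have Zcl : closed (@toric_pi _ _ _ p Sigma @` ray_tail v m).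
    apply: closed_toric_image; first exact: glue_invariant_ray_tail.
    by move=> t; exact: closed_ray_tail.
  have [b bW bE] : (@toric_pi _ _ _ p Sigma @` ray_tail v m) y.
    apply: Zcl => B yB; apply: ycl yB.
    by exists m => // n /= mn; exists (a n) => //; exact: aE.
  have tail_inv := @glue_invariant_ray_tail v m.
  by apply: (glue_invariant_toric_pi tail_inv _ bW); rewrite bE.
have [u su uv] :=
  polyhedral_separation p_nondegenerate (Spoly _ (set_valP s)) (sv s).
pose u' : dual_cone p (\val s) := exist _ u (mem_set su).
have f0 : 0 <= \val f u' by case: (set_valP f) => f0 _ _ _; exact: f0.
have fE m : exists2 r : R, m%:R <= r & \val f u' = expR (r * - p u v).
  have [r mr rE] := tail m; exists r => //.
  by rewrite mulrN; exact: (rE u').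
move: (\val f u') f0 fE => c c0 cE.
have /archi_boundP : 0 <= c / - p u v by rewrite divr_ge0// oppr_ge0 ltW.
rewrite ltr_pdivrMr ?oppr_gt0//; set m := Num.bound _ => cm.
have [r mr c_exp] := cE m; have := expR_ge1Dx (r * - p u v); rewrite -c_exp.
have : m%:R * - p u v <= r * - p u v by rewrite ler_pM2r// oppr_gt0.
by move=> mr' rc; have := lt_le_trans cm mr'; lra.
Qed.

End Compactness.

Theorem theorem4p5 (R : realType) (M N : vectType R)
    (p : {bilinear M -> N -> R | *%R & *%R})
    (p_nondegenerate : nondegenerate_pairing p)
    (Sigma : set (set N)) (Sigma_fan : fan p Sigma) (Sigma_neq0 : Sigma !=set0) :
  compact [set: irrational_toric_variety p Sigma] <-> complete_fan Sigma.
Proof.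
split; first exact: compact_complete.
exact: complete_compact.
Qed.
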